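(* Let $a,b$ be real numbers with $0<a<b$, let $q>1$ and let $p$ satisfy $\frac1p+\frac1q=1$. Then $$\left|\frac{1}{L(a,b)}-\frac{1}{H(a,b)}-\frac{1}{2A(a,b)}\right|\le\frac{1}{4^{1+1/q}}L_{p}(a,b)\left[\bigl(b^{-2q}+3a^{-2q}\bigr)^{1/q}+\bigl(a^{-2q}+3b^{-2q}\bigr)^{1/q}\right].$$
   Context: For $0<a<b$: $A(a,b)=\frac{a+b}{2}$ (arithmetic mean), $H(a,b)=\frac{2ab}{a+b}$ (harmonic mean), $L(a,b)=\frac{b-a}{\ln b-\ln a}$ (logarithmic mean), and $L_{p}(a,b)=\left(\frac{b^{p+1}-a^{p+1}}{(p+1)(b-a)}\right)^{1/p}$ for real $p\neq-1,0$ (generalized logarithmic mean). *)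

(* Defs.v *)
From Stdlib Require Import Reals.
Open Scope R_scope.

Definition arithmetic_mean (a b : R) : R := (a + b) / 2.

Definition harmonic_mean (a b : R) : R := 2 * a * b / (a + b).

(* Meaningful for positive a <> b. *)
Definition logarithmic_mean (a b : R) : R := (b - a) / (ln b - ln a).

(* Meaningful for positive a <> b and p <> -1, 0. *)
Definition generalized_logarithmic_mean (p a b : R) : R :=
  Rpower ((Rpower b (p + 1) - Rpower a (p + 1)) / ((p + 1) * (b - a))) (1 / p).

(* Main.v *)
(* Since [p, q > 1], Jensen's inequality replaces the generalized logarithmic
   mean by [(a + b) / 2] and each bracketed power mean by the corresponding
   arithmetic mean of [a^-2] and [b^-2], so the right-hand side is at least
   [(a + b) (1/a^2 + 1/b^2) / 8]. The inequality left over is rational once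
   [ln b - ln a] is enclosed between [2 (b - a) / (a + b)] and [b/a - 1]. *)
Require Import Defs.
From Stdlib Require Import Reals Lra Psatz.
Open Scope R_scope.

Lemma derive_nonneg_le (f f' : R -> R) (a b : R) :
  a <= b ->
  (forall x, a <= x <= b -> derivable_pt_lim f x (f' x)) ->
  (forall x, a <= x <= b -> 0 <= f' x) ->
  f a <= f b.
Proof.
intros hab hf hf'.
destruct (Req_dec a b) as [->|hne]; [lra|].
destruct (MVT_cor2 f f' a b) as [c [hc hcab]]; [lra|exact hf|].
assert (0 <= f' c) by (apply hf'; lra).
nra.
Qed.

(** Convexity of the power function. The mean value theorem gives the chord from [m] to [x] the
    slope [r * c ^ (r - 1)] with [c] between them; this slope is monotone in [c], and on each side
    of [m] the sign of [x - m] turns the comparison the same way. *)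
Lemma Rpower_tangent_le (r m x : R) :
  1 <= r -> 0 < m -> 0 < x ->
  Rpower m r + r * Rpower m (r - 1) * (x - m) <= Rpower x r.
Proof.
intros hr hm hx.
destruct (Rtotal_order x m) as [hlt|[->|hlt]].
- destruct (MVT_cor2 (fun y => Rpower y r) (fun y => r * Rpower y (r - 1)) x m)
    as [c [hc hcxm]]; [lra| |].
  { intros y hy; apply derivable_pt_lim_power; lra. }
  assert (Rpower c (r - 1) <= Rpower m (r - 1)) by (apply Rle_Rpower_l; lra).
  assert (r * Rpower c (r - 1) <= r * Rpower m (r - 1)) by nra.
  nra.
- lra.
- destruct (MVT_cor2 (fun y => Rpower y r) (fun y => r * Rpower y (r - 1)) m x)
    as [c [hc hcmx]]; [lra| |].
  { intros y hy; apply derivable_pt_lim_power; lra. }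
  assert (Rpower m (r - 1) <= Rpower c (r - 1)) by (apply Rle_Rpower_l; lra).
  assert (r * Rpower m (r - 1) <= r * Rpower c (r - 1)) by nra.
  nra.
Qed.

Lemma Rpower_inv_le (r x y : R) :
  0 < r -> 0 < x -> Rpower x r <= y -> x <= Rpower y (1 / r).
Proof.
intros hr hx hxy.
replace x with (Rpower (Rpower x r) (1 / r)) at 1.
- apply Rle_Rpower_l.
  + apply Rlt_le, Rdiv_lt_0_compat; lra.
  + split; [apply exp_pos|exact hxy].
- rewrite Rpower_mult; replace (r * (1 / r)) with 1 by (field; lra).
  now apply Rpower_1.
Qed.

(** Jensen for two points: average the tangent inequalities taken at the weighted mean itself. *)
Lemma weighted_mean_le_power_mean (r w x y : R) :
  1 <= r -> 0 <= w <= 1 -> 0 < x -> 0 < y ->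
  w * x + (1 - w) * y
    <= Rpower (w * Rpower x r + (1 - w) * Rpower y r) (1 / r).
Proof.
intros hr hw hx hy.
assert (hm : 0 < w * x + (1 - w) * y).
{ destruct (Rle_lt_dec w (1 / 2)); nra. }
apply Rpower_inv_le; [lra|exact hm|].
pose proof (Rpower_tangent_le r _ x hr hm hx) as h1.
pose proof (Rpower_tangent_le r _ y hr hm hy) as h2.
set (m := w * x + (1 - w) * y) in *.
apply (Rmult_le_compat_l w) in h1; [|lra].
apply (Rmult_le_compat_l (1 - w)) in h2; [|lra].
(* The linear terms cancel because the weighted deviations from [m] sum to zero. *)
assert (hz : w * (r * Rpower m (r - 1) * (x - m))
             + (1 - w) * (r * Rpower m (r - 1) * (y - m)) = 0).
{ unfold m at 2 4; ring. }
lra.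
Qed.

(** The base of the outer power is the integral mean of [x ^ p] over [[a, b]]. By convexity it is at
    least [m ^ p] at the midpoint [m] (Hermite-Hadamard); integrals are avoided by using an
    antiderivative. *)
Lemma arithmetic_mean_le_generalized_logarithmic_mean (p a b : R) :
  1 <= p -> 0 < a -> a < b ->
  arithmetic_mean a b <= generalized_logarithmic_mean p a b.
Proof.
intros hp ha hab; unfold generalized_logarithmic_mean, arithmetic_mean.
set (m := (a + b) / 2).
assert (hm : 0 < m) by (unfold m; lra).
apply Rpower_inv_le; [lra|exact hm|].
(* The derivative of [G] is the gap between [x^p] and its tangent at [m]. *)
pose (G := fun x => / (p + 1) * Rpower x (p + 1)
                    - (Rpower m p * x + p * Rpower m (p - 1) / 2 * (x - m) ^ 2)).
assert (hG : G a <= G b).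
(* The derivative is left unsimplified, in the shape that the differentiation rules produce. *)
{ apply (derive_nonneg_le G
    (fun x => / (p + 1) * ((p + 1) * Rpower x (p + 1 - 1))
       - (Rpower m p * 1
          + p * Rpower m (p - 1) / 2 * (INR 2 * (x - m) ^ 1 * (1 - 0))))).
  - lra.
  - intros x hx; unfold G.
    apply derivable_pt_lim_minus with
      (f1 := fun x => / (p + 1) * Rpower x (p + 1)).
    + apply (derivable_pt_lim_scal (fun x => Rpower x (p + 1))).
      apply derivable_pt_lim_power; lra.
    + apply (derivable_pt_lim_plus (fun x => Rpower m p * x)
        (fun x => p * Rpower m (p - 1) / 2 * (x - m) ^ 2)).
      * apply (derivable_pt_lim_scal id), derivable_pt_lim_id.
      * apply (derivable_pt_lim_scal (fun x => (x - m) ^ 2)).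
        apply (derivable_pt_lim_comp (fun x => x - m) (fun y => y ^ 2)).
        -- apply (derivable_pt_lim_minus id (fct_cte m)).
           ++ apply derivable_pt_lim_id.
           ++ apply derivable_pt_lim_const.
        -- apply (derivable_pt_lim_pow _ 2).
  - intros x hx.
    pose proof (Rpower_tangent_le p m x hp hm) as ht.
    replace (p + 1 - 1) with p by ring.
    replace (/ (p + 1) * ((p + 1) * Rpower x p)) with (Rpower x p)
      by (field; lra).
    simpl; lra. }
unfold G in hG.
(* The endpoints are symmetric about [m], so the quadratic terms cancel and [m ^ p * (b - a)]
   remains. *)
replace ((b - m) ^ 2) with ((a - m) ^ 2) in hG by (unfold m; field).
replace ((Rpower b (p + 1) - Rpower a (p + 1)) / ((p + 1) * (b - a)))
  with ((/ (p + 1) * Rpower b (p + 1) - / (p + 1) * Rpower a (p + 1)) / (b - a))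
  by (field; lra).
apply (Rmult_le_reg_r (b - a)); [lra|].
unfold Rdiv at 1; rewrite Rmult_assoc, Rinv_l, Rmult_1_r by lra.
lra.
Qed.

Lemma logarithmic_mean_le_arithmetic_mean_inv (a b : R) :
  0 < a -> a < b -> 2 / (a + b) <= 1 / logarithmic_mean a b.
Proof.
intros ha hab; unfold logarithmic_mean.
assert (hln : 0 < ln b - ln a) by (pose proof (ln_increasing a b ha hab); lra).
(* The bracket is [2 * (x - a) / (x + a)], which vanishes at [a]; the derivative of [F] simplifies
   to [(x - a) ^ 2 / (x * (x + a) ^ 2)]. *)
pose (F := fun x => ln x - (2 - 4 * a / (x + a))).
assert (hF : F a <= F b).
{ apply (derive_nonneg_le F
    (fun x => / x - (0 - (0 * (x + a) - (1 + 0) * (4 * a)) / (x + a)²))).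
  - lra.
  - intros x hx; unfold F.
    apply (derivable_pt_lim_minus ln (fun x => 2 - 4 * a / (x + a))).
    + apply derivable_pt_lim_ln; lra.
    + apply (derivable_pt_lim_minus (fct_cte 2) (fun x => 4 * a / (x + a))).
      * apply derivable_pt_lim_const.
      * apply (derivable_pt_lim_div (fct_cte (4 * a)) (fun x => x + a)).
        -- apply derivable_pt_lim_const.
        -- apply (derivable_pt_lim_plus id (fct_cte a)).
           ++ apply derivable_pt_lim_id.
           ++ apply derivable_pt_lim_const.
        -- lra.
  - intros x hx.
    replace (/ x - (0 - (0 * (x + a) - (1 + 0) * (4 * a)) / (x + a)²))
      with ((x - a) ^ 2 / (x * (x + a) ^ 2)) by (unfold Rsqr; field; lra).
    apply Rle_mult_inv_pos; [nra|].
    apply Rmult_lt_0_compat; [|apply pow_lt]; lra. }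
unfold F in hF.
replace (4 * a / (a + a)) with 2 in hF by (field; lra).
replace (1 / ((b - a) / (ln b - ln a))) with ((ln b - ln a) / (b - a))
  by (field; lra).
apply (Rmult_le_reg_r (b - a)); [lra|].
replace ((ln b - ln a) / (b - a) * (b - a)) with (ln b - ln a) by (field; lra).
replace (2 / (a + b) * (b - a)) with (2 - 4 * a / (b + a)) by (field; lra).
lra.
Qed.

Lemma logarithmic_mean_inv_le (a b : R) :
  0 < a -> a < b -> 1 / logarithmic_mean a b <= 1 / a.
Proof.
intros ha hab; unfold logarithmic_mean.
assert (hln : 0 < ln b - ln a) by (pose proof (ln_increasing a b ha hab); lra).
replace (1 / ((b - a) / (ln b - ln a))) with ((ln b - ln a) / (b - a))
  by (field; lra).
apply (Rmult_le_reg_r (b - a)); [lra|].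
replace ((ln b - ln a) / (b - a) * (b - a)) with (ln b - ln a) by (field; lra).
replace (1 / a * (b - a)) with (b / a - 1) by (field; lra).
(* The bound [1 + t <= exp t] at [t = ln b - ln a], where [exp t] is [b / a]. *)
pose proof (exp_ineq1_le (ln b - ln a)) as h.
unfold Rminus in h at 2.
rewrite exp_plus, exp_Ropp, !exp_ln in h by lra.
unfold Rdiv; lra.
Qed.

(** Dividing by [4 ^ (1 / q)] turns the coefficients 1 and 3 into the weights 1/4 and 3/4, giving a
    power mean of [x ^ -2] and [y ^ -2]. *)
Lemma Rpower_bracket_ge (q x y : R) :
  1 <= q -> 0 < x -> 0 < y ->
  (/ x ^ 2 + 3 * / y ^ 2) / 4
    <= Rpower (Rpower x (- 2 * q) + 3 * Rpower y (- 2 * q)) (1 / q)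
       / Rpower 4 (1 / q).
Proof.
intros hq hx hy.
assert (hpow : forall z, 0 < z -> Rpower z (- 2 * q) = Rpower (/ z ^ 2) q).
{ intros z hz.
  rewrite <- (Rpower_pow 2 z hz), <- Rpower_Ropp, Rpower_mult.
  f_equal; simpl; ring. }
rewrite !hpow by assumption.
pose proof (weighted_mean_le_power_mean q (1 / 4) (/ x ^ 2) (/ y ^ 2) hq) as h.
assert (h4 : forall u, 0 < u ->
  Rpower u (1 / q) / Rpower 4 (1 / q) = Rpower (u / 4) (1 / q)).
{ intros u hu.
  replace u with (u / 4 * 4) at 1 by field.
  rewrite <- Rpower_mult_distr by lra.
  field; apply Rgt_not_eq, exp_pos. }
assert (0 < Rpower (/ x ^ 2) q) by apply exp_pos.
assert (0 < Rpower (/ y ^ 2) q) by apply exp_pos.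
rewrite h4 by lra.
replace ((Rpower (/ x ^ 2) q + 3 * Rpower (/ y ^ 2) q) / 4)
  with (1 / 4 * Rpower (/ x ^ 2) q + (1 - 1 / 4) * Rpower (/ y ^ 2) q) by field.
assert (0 < / x ^ 2) by (apply Rinv_0_lt_compat, pow_lt; lra).
assert (0 < / y ^ 2) by (apply Rinv_0_lt_compat, pow_lt; lra).
lra.
Qed.

Lemma conjugate_exponent_gt_1 (p q : R) :
  1 < q -> 1 / p + 1 / q = 1 -> 1 < p.
Proof.
intros hq hpq.
assert (hq1 : / q < 1) by (rewrite <- Rinv_1; apply Rinv_lt_contravar; lra).
assert (hq0 : 0 < / q) by (apply Rinv_0_lt_compat; lra).
unfold Rdiv in hpq.
rewrite <- (Rinv_inv p), <- Rinv_1.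
apply Rinv_lt_contravar; lra.
Qed.

Theorem proposition4 (a b p q : R) (ha : 0 < a) (hab : a < b)
    (hq : 1 < q) (hpq : 1 / p + 1 / q = 1) :
  Rabs (1 / logarithmic_mean a b - 1 / harmonic_mean a b
        - 1 / (2 * arithmetic_mean a b))
  <= 1 / Rpower 4 (1 + 1 / q) * generalized_logarithmic_mean p a b
     * (Rpower (Rpower b (- 2 * q) + 3 * Rpower a (- 2 * q)) (1 / q)
        + Rpower (Rpower a (- 2 * q) + 3 * Rpower b (- 2 * q)) (1 / q)).
Proof.
assert (hp : 1 < p) by exact (conjugate_exponent_gt_1 p q hq hpq).
assert (hm := arithmetic_mean_le_generalized_logarithmic_mean p a b
                (Rlt_le _ _ hp) ha hab).
assert (hb := Rpower_bracket_ge q b a).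
assert (hb' := Rpower_bracket_ge q a b).
assert (hlo := logarithmic_mean_le_arithmetic_mean_inv a b ha hab).
assert (hup := logarithmic_mean_inv_le a b ha hab).
assert (h4 : 0 < Rpower 4 (1 / q)) by apply exp_pos.
rewrite Rpower_plus, Rpower_1 by lra.
set (B1 := Rpower (Rpower b _ + _) _) in *.
set (B2 := Rpower (Rpower a _ + _) _) in *.
set (M := generalized_logarithmic_mean p a b) in *.
(* The factor [4 ^ (1 / q)] normalises both brackets; a single 1/4 stays outside. *)
replace (1 / (4 * Rpower 4 (1 / q)) * M * (B1 + B2))
  with (1 / 4 * (M * (B1 / Rpower 4 (1 / q) + B2 / Rpower 4 (1 / q))))
  by (field; lra).
assert (hia : 0 < / a ^ 2) by (apply Rinv_0_lt_compat, pow_lt; lra).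
assert (hib : 0 < / b ^ 2) by (apply Rinv_0_lt_compat, pow_lt; lra).
(* The two brackets swap the weights 1/4 and 3/4, so their lower bounds add up to the symmetric
   sum. *)
assert (hrhs : arithmetic_mean a b * (/ a ^ 2 + / b ^ 2)
  <= M * (B1 / Rpower 4 (1 / q) + B2 / Rpower 4 (1 / q))).
{ apply Rmult_le_compat; [unfold arithmetic_mean| |exact hm|]; lra. }
apply Rle_trans with (1 / 4 * (arithmetic_mean a b * (/ a ^ 2 + / b ^ 2)));
  [|lra].
(* From here on only [hlo] and [hup] are known about [l]. *)
set (l := 1 / logarithmic_mean a b) in *; clearbody l.
unfold harmonic_mean, arithmetic_mean.
assert (hab0 : 0 < a * b) by nra.
assert (hden : 0 < 8 * (a * b) ^ 2 * (a + b)).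
{ apply Rmult_lt_0_compat; [|lra].
  apply Rmult_lt_0_compat; [lra|now apply pow_lt]. }
assert (hnum : 0 <= (a ^ 2 + b ^ 2) * (a - b) ^ 2).
{ apply Rmult_le_pos; [nra|apply pow2_ge_0]. }
apply Rabs_le; split.
(* Lower side: with [l] replaced by [2 / (a + b)], the gap over the common denominator has numerator
   exactly [(a ^ 2 + b ^ 2) * (a - b) ^ 2]. *)
- apply Rle_trans with
    (2 / (a + b) - 1 / (2 * a * b / (a + b)) - 1 / (2 * ((a + b) / 2)));
    [|lra].
  apply Rminus_le.
  match goal with |- ?e <= 0 =>
    replace e with (- ((a ^ 2 + b ^ 2) * (a - b) ^ 2
                       / (8 * (a * b) ^ 2 * (a + b)))) by (field; lra) end.
  apply Rge_le, Ropp_0_le_ge_contravar, Rle_mult_inv_pos; [exact hnum|exact hden].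
(* Upper side: with [l] replaced by [1 / a], the same numerator appears with further nonnegative
   terms, so the crude bound suffices. *)
- apply Rle_trans with
    (1 / a - 1 / (2 * a * b / (a + b)) - 1 / (2 * ((a + b) / 2))); [lra|].
  apply Rminus_le.
  match goal with |- ?e <= 0 =>
    replace e with (- (((a ^ 2 + b ^ 2) * (a - b) ^ 2
                        + 8 * (a * b) * a ^ 2 + 8 * (a * b) ^ 2)
                       / (8 * (a * b) ^ 2 * (a + b)))) by (field; lra) end.
  apply Rge_le, Ropp_0_le_ge_contravar, Rle_mult_inv_pos; [|exact hden].
  assert (0 <= a * b * a ^ 2) by (apply Rmult_le_pos; [lra|apply pow2_ge_0]).
  pose proof (pow2_ge_0 (a * b)); lra.
Qed.
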